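(* Let $n\ge 4$, $a\in\mathbb{Z}^n$, $b\in\mathbb{Z}$ and $P=\{x\in[0,1]^n\mid a^Tx\le b\}$. Then there exists a matrix $W\in\mathbb{Z}^{(n-2)\times n}$ such that $$\operatorname{conv}(P\cap\mathbb{Z}^n)=\operatorname{conv}(\{x\in P\mid Wx\in\mathbb{Z}^{n-2}\}).$$ *)

(* Defs.v *)
From mathcomp Require Import all_boot all_order all_algebra.
From mathcomp Require Import boolp classical_sets reals topology convex.

Set Implicit Arguments.
Unset Strict Implicit.
Unset Printing Implicit Defensive.

Import Order.TTheory GRing.Theory Num.Theory.
Local Open Scope classical_set_scope.
Local Open Scope ring_scope.

Definition conv_hull (R : numDomainType) (E : lmodType R) (A : set E) : set E :=
  smallest (@convex_set R E) A.

Definition int_points (R : realType) (m : nat) : set 'cV[R]_m :=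
  [set y | y \is a mxOver (@Num.int R)].
Arguments int_points R m : clear implicits.

Definition cube01 (R : realType) (n : nat) : set 'cV[R]_n :=
  [set x | forall i, 0 <= x i 0 <= 1].
Arguments cube01 R n : clear implicits.

Definition knapsack01 (R : realType) (n : nat) (a : 'cV[int]_n) (b : int)
    : set 'cV[R]_n :=
  [set x | cube01 R n x /\ ((map_mx intr a)^T *m x) 0 0 <= b%:~R].
Arguments knapsack01 R {n} a b _.

(* Main.v *)
(** Perturbing a hyperplane that separates the feasible from the infeasible 0/1 points
    produces one with at least [n + 1 >= 5] of these points at minimal distance: otherwise
    the tight constraints leave a direction of motion, and moving along it makes a further
    point tight.  Hence three distinct 0/1 points [p1, p2, p3] lie on one side at the same
    level of a linear functional [c] whose value at a 0/1 point decides its feasibility.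
    Let [K] be the plane spanned by [p1 - p3] and [p2 - p3].  This basis is totally
    unimodular, so some integer [W] satisfies [W x \in Z^(n-2) <-> x \in Z^n + K], and
    every point of the cube in [z + K], [z] integral, is a convex combination of 0/1 points
    of [z + K].  As [c] is constant on [z + K], these are all feasible or all infeasible;
    in the latter case the given point violates the knapsack constraint. *)

Require Import Defs.
From mathcomp Require Import all_boot all_order all_algebra.
From mathcomp Require Import boolp classical_sets reals topology convex.
From mathcomp Require Import interval_inference ring lra zify.
Import Order.TTheory GRing.Theory Num.Theory.
Local Open Scope classical_set_scope.
Local Open Scope ring_scope.

(** * Moving a point until many linear inequalities are tight *)

Lemma small_family_kernel (F : fieldType) (m : nat) (T : finType)
    (v : T -> 'rV[F]_m) (S : {set T}) :
  (#|S| < m)%N ->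
  exists2 d : 'cV[F]_m, d != 0 & forall t, t \in S -> (v t *m d) 0 0 = 0.
Proof.
move=> lt_Sm; pose M := \matrix_(k < #|S|) v (enum_val k).
have kn0 : kermx M^T != 0.
  rewrite -mxrank_eq0 mxrank_ker mxrank_tr subn_eq0 -ltnNge.
  exact: leq_ltn_trans (rank_leq_row M) lt_Sm.
exists (nz_row (kermx M^T))^T.
  by rewrite -(inj_eq trmx_inj) trmxK trmx0 nz_row_eq0.
move=> t St.
have /sub_kermxP/(congr1 trmx) := nz_row_sub (kermx M^T).
rewrite trmx_mul trmxK trmx0 => /matrixP/(_ (enum_rank_in St t) 0).
rewrite !mxE => kd0; rewrite -[RHS]kd0; apply: eq_bigr => j _.
by rewrite !mxE enum_rankK_in.
Qed.

(** Induction on the number of tight inequalities: fewer than [m] of them leave a nonzero direction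
    [d] along which they stay tight. Since the [v t] span, some other inequality varies along [d],
    and moving as far as possible makes a new one tight. *)
Lemma exists_many_tight (F : realFieldType) (m : nat) (T : finType)
    (v : T -> 'rV[F]_m) (c0 : 'cV[F]_m) :
  (forall t, 1 <= (v t *m c0) 0 0) ->
  (forall d : 'cV[F]_m, (forall t, (v t *m d) 0 0 = 0) -> d = 0) ->
  exists2 c : 'cV[F]_m, (forall t, 1 <= (v t *m c) 0 0) &
    (m <= #|[set t | (v t *m c) 0 0 == 1 :> F]%R%SET|)%N.
Proof.
move=> c0P vP.
suff H k : (k <= m)%N -> exists2 c : 'cV[F]_m, (forall t, 1 <= (v t *m c) 0 0) &
    (k <= #|[set t | (v t *m c) 0 0 == 1 :> F]%R%SET|)%N by exact: H.
elim: k => [_|k IH ltkm]; first by exists c0.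
have [c cP] := IH (ltnW ltkm).
set S := [set t | _]%SET; rewrite leq_eqVlt => /predU1P[Sk|?]; last by exists c.
have [d dn0 dS] : exists2 d : 'cV[F]_m, d != 0 &
    forall t, t \in S -> (v t *m d) 0 0 = 0.
  by apply: small_family_kernel; rewrite -Sk.
have [t0 t0d] : exists t, (v t *m d) 0 0 != 0.
  apply/existsP; apply: contraNT dn0 => /existsPn vd; apply/eqP/vP => t.
  by have /negPn/eqP := vd t.
wlog t0neg : d dn0 dS t0d / (v t0 *m d) 0 0 < 0.
  move=> wl; case: (ltrgtP ((v t0 *m d) 0 0) 0) t0d => // t0d _.
    by apply: (wl d) => //; rewrite lt_eqF.
  have vN t : (v t *m - d) 0 0 = - (v t *m d) 0 0 by rewrite mulmxN [LHS]mxE.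
  apply: (wl (- d)); rewrite ?vN ?oppr_eq0 ?oppr_lt0 ?gt_eqF //.
  by move=> t /dS; rewrite vN => ->; rewrite oppr0.
(* For a decreasing inequality, [step t] is the length of the move at which it becomes tight; the
   least such length violates none. *)
pose step t := ((v t *m c) 0 0 - 1) / - (v t *m d) 0 0.
have [t1 t1neg t1min] :=
  @Order.TotalTheory.arg_minP _ F T t0 (fun t => (v t *m d) 0 0 < 0) step t0neg.
have stepE t : (v t *m (c + step t1 *: d)) 0 0 =
    (v t *m c) 0 0 + step t1 * (v t *m d) 0 0.
  by rewrite mulmxDr -scalemxAr [LHS]mxE [X in _ + X]mxE.
have step_ge0 : 0 <= step t1.
  by rewrite /step divr_ge0 ?subr_ge0 ?cP ?oppr_ge0 ?ltW.
exists (c + step t1 *: d).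
  move=> t; rewrite stepE; have ct := cP t.
  have [dt|dt] := ltP ((v t *m d) 0 0) 0; last first.
    by rewrite -[1]addr0 lerD // mulr_ge0.
  have := t1min _ dt; rewrite [leRHS]/step ler_pdivlMr ?oppr_gt0 //.
  by lra.
have t1S : t1 \notin S by apply/negP => /dS t1d; rewrite t1d ltxx in t1neg.
suff /subset_leq_card : (t1 |: S)%SET \subset
    [set t | (v t *m (c + step t1 *: d)) 0 0 == 1]%SET.
  by rewrite cardsU1 t1S add1n Sk.
apply/fintype.subsetP => t; rewrite !inE stepE => /predU1P[->|tS].
  by rewrite /step; apply/eqP; field; rewrite lt_eqF.
by rewrite dS ?inE // mulr0 addr0.
Qed.

(** * Convex combinations with possibly vanishing weights *)

(** Membership is asked only under positive weight, because a triangle vertex of weight zero may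
    fall outside the cube. *)
Lemma convex_set_comb2 (R : numFieldType) (E : lmodType R) (C : set E)
    (p q : E) (s t : R) :
  @convex_set R E C -> 0 <= s -> 0 <= t -> s + t = 1 ->
  (0 < s -> C p) -> (0 < t -> C q) -> C (s *: p + t *: q).
Proof.
move=> cC s0 t0 st1 Cp Cq.
have tE : t = 1 - s by rewrite -st1 addrC addKr.
have [s00|sn0] := eqVneq s 0.
  move: st1 Cq; rewrite s00 add0r => -> Cq.
  by rewrite scale0r scale1r add0r; apply: Cq.
have [t00|tn0] := eqVneq t 0.
  move: st1 Cp; rewrite t00 addr0 => -> Cp.
  by rewrite scale0r scale1r addr0; apply: Cp.
have s1 : s <= 1 by rewrite -subr_ge0 -tE.
have := cC p q (Itv01 s0 s1).
rewrite !in_setE tE; apply.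
  by apply: Cp; rewrite lt0r sn0.
by apply: Cq; rewrite lt0r tn0.
Qed.

Lemma convex_set_comb3 (R : numFieldType) (E : lmodType R) (C : set E)
    (p q r : E) (s t u : R) :
  @convex_set R E C -> 0 <= s -> 0 <= t -> 0 <= u -> s + t + u = 1 ->
  (0 < s -> C p) -> (0 < t -> C q) -> (0 < u -> C r) ->
  C (s *: p + t *: q + u *: r).
Proof.
move=> cC s0 t0 u0 stu1 Cp Cq Cr.
have st0 : 0 <= s + t by rewrite addr_ge0.
have [st00|stn0] := eqVneq (s + t) 0.
  move: (st00) stu1 Cr => /eqP; rewrite paddr_eq0 // => /andP[/eqP -> /eqP ->].
  rewrite !add0r => -> Cr; rewrite !scale0r !add0r scale1r; exact: Cr.
have st_gt0 : 0 < s + t by rewrite lt0r stn0.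
have -> : s *: p + t *: q = (s + t) *: ((s / (s + t)) *: p + (t / (s + t)) *: q).
  by rewrite scalerDr !scalerA !(mulrC (s + t)) !divfK.
apply: convex_set_comb2 => // _.
apply: convex_set_comb2 => //; rewrite ?divr_ge0 ?pmulr_lgt0 ?invr_gt0 //.
by rewrite -mulrDl divff.
Qed.

(** * Lattice planes spanned by differences of 0/1 points *)

Definition vertex (R : realType) (n : nat) (p : {ffun 'I_n -> bool}) : 'cV[R]_n :=
  \col_i (p i)%:R.
Arguments vertex R {n} p.

Lemma cube01_int_vertex (R : realType) (n : nat) (y : 'cV[R]_n) :
  cube01 R n y -> int_points R n y -> exists p, y = vertex R p.
Proof.
move=> y01 /mxOverP yint.
exists [ffun i => y i 0 == 1]; apply/colP => i; rewrite !mxE ffunE.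
have /intrP[k yk] := yint i 0; have /andP[] := y01 i.
rewrite yk ler0z lerz1 => k0 k1.
have [->|kn1] := eqVneq k 1; first by rewrite eqxx.
have -> : k = 0 by lia.
by rewrite eq_sym oner_eq0.
Qed.

Lemma int_near_cube01 (R : realType) (n : nat) (x y : 'cV[R]_n) :
  cube01 R n x -> int_points R n y -> (forall i, `|x i 0 - y i 0| < 1) ->
  cube01 R n y.
Proof.
move=> x01 /mxOverP yint xy i.
have /intrP[k yk] := yint i 0; have /andP[] := x01 i; have := xy i.
rewrite yk ltr_norml => /andP[xk1 xk2 x0 x1].
have : (-1)%:~R < k%:~R :> R by lra.
have : k%:~R < 2%:~R :> R by lra.
rewrite !ltr_int ler0z lerz1; lia.
Qed.

(* Modulo 1, [(s, t)] lies in the unit square, which the diagonal [s + t = 1] cuts into two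
   triangles.  A vertex of the triangle containing [(s, t)] that has positive weight gives a
   lattice point at sup-distance less than 1 from [x], because the pairs [(U i 0, V i 0)] are,
   up to sign, [(0, 0)], [(1, 0)], [(0, 1)] or [(1, 1)]; being integral, it is in the cube. *)
Lemma cube01_plane_hull (R : realType) (n : nat) (p1 p2 p3 : {ffun 'I_n -> bool})
    (U := vertex R p1 - vertex R p3) (V := vertex R p2 - vertex R p3)
    (x z : 'cV[R]_n) (s t : R) :
  cube01 R n x -> int_points R n z -> x = z + s *: U + t *: V ->
  conv_hull [set y | [/\ cube01 R n y, int_points R n y &
                         exists s' t', y = x + s' *: U + t' *: V]] x.
Proof.
move=> x01; wlog /andP[s01 t01] : z s t / (0 <= s < 1) && (0 <= t < 1).
  move=> wl zint xE.
  apply: (wl (z + (Num.floor s)%:~R *: U + (Num.floor t)%:~R *: V)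
             (s - (Num.floor s)%:~R) (t - (Num.floor t)%:~R)).
  - have := floor_itv s; have := floor_itv t; rewrite !intrD.
    by move=> /andP[? ?] /andP[? ?]; do 2 (apply/andP; split); lra.
  - apply/mxOverP => i j; rewrite ord1 !mxE.
    rewrite !(rpredD, rpredN, rpredM, intr_int, natr_int) //.
    exact: (mxOverP zint).
    rewrite xE; apply/colP => i; rewrite !mxE; ring.
move=> zint xE C [cC QC].
have Q k l : (forall i, `|(s - k%:~R) * U i 0 + (t - l%:~R) * V i 0| < 1) ->
    C (z + k%:~R *: U + l%:~R *: V).
  move=> near; have yint : int_points R n (z + k%:~R *: U + l%:~R *: V).
    apply/mxOverP => i j; rewrite ord1 !mxE.
    rewrite !(rpredD, rpredN, rpredM, intr_int, natr_int) //.
    exact: (mxOverP zint).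
  apply: QC; split => //.
    apply: (int_near_cube01 _ _ x _ x01 yint) => i.
    by apply: le_lt_trans (near i); rewrite xE !mxE le_eqVlt; apply/orP; left;
      apply/eqP; congr (`| _ |); ring.
  by exists (k%:~R - s), (l%:~R - t); rewrite xE; apply/colP => i; rewrite !mxE; ring.
have bits i : exists (b1 b2 b3 : bool),
    U i 0 = b1%:R - b3%:R /\ V i 0 = b2%:R - b3%:R.
  by exists (p1 i), (p2 i), (p3 i); rewrite !mxE.
have [st1|st1] := lerP (s + t) 1.
  have -> : x = (1 - s - t) *: (z + 0%:~R *: U + 0%:~R *: V) +
     s *: (z + 1%:~R *: U + 0%:~R *: V) + t *: (z + 0%:~R *: U + 1%:~R *: V).
    by rewrite xE; apply/colP => i; rewrite !mxE; ring.
  apply: convex_set_comb3 => //; [lra|lra|lra|lra|move=> w..];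
    apply: Q => i; have [[] [[] [[] [-> ->]]]] := bits i;
    rewrite ltr_norml /=; apply/andP; split; lra.
have -> : x = (s + t - 1) *: (z + 1%:~R *: U + 1%:~R *: V) +
   (1 - t) *: (z + 1%:~R *: U + 0%:~R *: V) + (1 - s) *: (z + 0%:~R *: U + 1%:~R *: V).
  by rewrite xE; apply/colP => i; rewrite !mxE; ring.
apply: convex_set_comb3 => //; [lra|lra|lra|lra|move=> w..];
  apply: Q => i; have [[] [[] [[] [-> ->]]]] := bits i;
  rewrite ltr_norml /=; apply/andP; split; lra.
Qed.

Lemma enum_avoiding2 (n : nat) (i j : 'I_n) : i != j ->
  exists g : 'I_(n - 2) -> 'I_n, forall l, l != i -> l != j -> exists r, g r = l.
Proof.
move=> ij; pose e := enum (~: [set i; j])%SET.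
have size_e : size e = (n - 2)%N by rewrite -cardE cardsCs finset.setCK cards2 ij card_ord.
(* The default [i] is never returned, as [e] has exactly [n - 2] entries. *)
exists (fun r => nth i e r) => l li lj.
have le : l \in e by rewrite mem_enum !inE negb_or li.
have lt_l : (index l e < n - 2)%N by rewrite -size_e index_mem.
by exists (Ordinal lt_l); rewrite /= nth_index.
Qed.

(** Let [U = p1 - p3] and [V = p2 - p3]. After relabelling the points, there are coordinates [i],
    [j] where [U] is [±1] and [0], and [V] is [0] and [±1]. Subtracting multiples of [U] and [V]
    from [x] clears both coordinates; the others become the entries of [W x]. *)
Lemma plane_int_matrix (R : realType) (n : nat) (p1 p2 p3 : {ffun 'I_n -> bool}) :
  p1 != p2 -> p2 != p3 -> p3 != p1 ->
  exists W : 'M[int]_(n - 2, n), forall x : 'cV[R]_n,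
    int_points R (n - 2) (map_mx intr W *m x) ->
    exists z s t, int_points R n z /\
      x = z + s *: (vertex R p1 - vertex R p3) + t *: (vertex R p2 - vertex R p3).
Proof.
move=> p12 p23 p31.
have /existsP[i pi12] : [exists i, p1 i != p2 i].
  apply: contraNT p12 => /existsPn h; apply/eqP/ffunP => i.
  by have /negPn/eqP := h i.
wlog pi23 : p1 p2 p12 p23 p31 pi12 / p2 i = p3 i.
  move=> wl; have [|p2i] := eqVneq (p2 i) (p3 i); first exact: wl.
  have p1i : p1 i = p3 i.
    by move: pi12 p2i; case: (p1 i) (p2 i) (p3 i) => [] [] [].
  have [p21 p13 p32] : [/\ p2 != p1, p1 != p3 & p3 != p2] by split; rewrite eq_sym.
  have [|W WP] := wl p2 p1 p21 p13 p32 _ p1i; first by rewrite eq_sym.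
  exists W => x /WP[z [s [t [zint xE]]]].
  by exists z, t, s; split=> //; rewrite xE addrAC.
have /existsP[j pj23] : [exists j, p2 j != p3 j].
  apply: contraNT p23 => /existsPn h; apply/eqP/ffunP => j.
  by have /negPn/eqP := h j.
wlog pj13 : p2 p3 p12 p23 p31 pi12 pi23 pj23 / p1 j = p3 j.
  move=> wl; have [|p1j] := eqVneq (p1 j) (p3 j); first exact: wl.
  have p1j2 : p1 j = p2 j.
    by move: pj23 p1j; case: (p1 j) (p2 j) (p3 j) => [] [] [].
  have [p21 p13 p32] : [/\ p2 != p1, p1 != p3 & p3 != p2] by split; rewrite eq_sym.
  have [||W WP] := wl p3 p2 p13 p32 p21 _ (esym pi23) _ p1j2.
  - by rewrite -pi23.
  - by rewrite eq_sym.
  exists W => x /WP[z [s [t [zint xE]]]].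
  (* With [p2] and [p3] exchanged, the spanning vectors are [U - V] and [- V]. *)
  exists z, s, (- s - t); split=> //.
  by rewrite xE; apply/colP => k; rewrite !mxE; ring.
have ij : i != j by apply: contra_neq pj23 => <-.
have [g gP] := enum_avoiding2 _ _ _ ij.
pose u l : int := (p1 l)%:Z - (p3 l)%:Z; pose v l : int := (p2 l)%:Z - (p3 l)%:Z.
(* The signs [u i] and [v j] are their own inverses, so the multiples to subtract are [u i * x i]
   and [v j * x j], and [W] is integral. *)
pose W : 'M[int]_(n - 2, n) := \matrix_(r, c)
  ((c == g r)%:Z - u i * u (g r) * (c == i)%:Z - v j * v (g r) * (c == j)%:Z).
have WE (x : 'cV[R]_n) r : (map_mx intr W *m x) r 0 =
    x (g r) 0 - (u i * u (g r))%:~R * x i 0 - (v j * v (g r))%:~R * x j 0.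
  have pick k : \sum_c (c == k)%:R * x c 0 = x k 0.
    rewrite (bigD1 k) //= eqxx mul1r big1 ?addr0 // => c /negPf ->.
    by rewrite mul0r.
  rewrite mxE -!pick !mulr_sumr -!sumrB; apply: eq_bigr => c _.
  by rewrite !mxE !(intrB, intrM) -!pmulrn; ring.
exists W => x /mxOverP Wx.
exists (x - (x i 0 * (u i)%:~R) *: (vertex R p1 - vertex R p3)
          - (x j 0 * (v j)%:~R) *: (vertex R p2 - vertex R p3)).
exists (x i 0 * (u i)%:~R), (x j 0 * (v j)%:~R); split; last first.
  by apply/colP => k; rewrite !mxE; ring.
apply/mxOverP => l k; rewrite ord1 {k} !mxE.
have [->|li] := eqVneq l i.
  rewrite /u /v pi23 subrr mulr0 subr0.
  have -> : x i 0 - x i 0 * ((p1 i)%:Z - (p3 i)%:Z)%:~R * ((p1 i)%:R - (p3 i)%:R) = 0.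
    by move: pi12; rewrite pi23; case: (p1 i) (p3 i) => [] [] //= _; ring.
  exact: int_num0.
have [->|lj] := eqVneq l j.
  rewrite /u /v pj13 subrr mulr0 subr0.
  have -> : x j 0 - x j 0 * ((p2 j)%:Z - (p3 j)%:Z)%:~R * ((p2 j)%:R - (p3 j)%:R) = 0.
    by move: pj23; case: (p2 j) (p3 j) => [] [] //= _; ring.
  exact: int_num0.
have [r rl] := gP l li lj.
set w := (X in X \in _); suff -> : w = (map_mx intr W *m x) r 0 by exact: Wx.
by rewrite WE rl /w /u /v !(intrM, intrB) -!pmulrn; ring.
Qed.

(** * A separating functional with three 0/1 points on one level *)

Lemma exists_three_level_functional (R : realType) (n : nat) (hn : (4 <= n)%N)
    (a : 'cV[int]_n) (b : int)
    (f := fun p => ((map_mx intr a)^T *m vertex R p) 0 0 <= b%:~R) :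
  exists (c : 'cV[R]_n) (p1 p2 p3 : {ffun 'I_n -> bool}),
    [/\ [/\ p1 != p2, p2 != p3 & p3 != p1],
        c^T *m (vertex R p1 - vertex R p3) = 0,
        c^T *m (vertex R p2 - vertex R p3) = 0 &
        forall p q, c^T *m vertex R p = c^T *m vertex R q -> f p = f q].
Proof.
(* With this sign, [1 <= v p *m c] puts the affine functional [c] at most [-1] at feasible points
   and at least [1] at infeasible ones. *)
pose v p : 'rV[R]_(n + 1) := (-1) ^+ f p *: row_mx (vertex R p)^T 1%:M.
have vE p (d : 'cV[R]_n) (d0 : R) : (v p *m col_mx d d0%:M) 0 0 =
    (-1) ^+ f p * ((d^T *m vertex R p) 0 0 + d0).
  rewrite -scalemxAl mul_row_col mul1mx [LHS]mxE [X in _ * X]mxE; congr (_ * (_ + _)).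
    by rewrite -[d in LHS]trmxK -trmx_mul mxE.
  by rewrite mxE eqxx mulr1n.
have [c cP cS] : exists2 c : 'cV[R]_(n + 1), (forall p, 1 <= (v p *m c) 0 0) &
    (n + 1 <= #|[set p | (v p *m c) 0 0 == 1 :> R]%R%SET|)%N.
  (* By integrality, [2 a^T p - (2 b + 1)] is at most [-1] if [a^T p <= b] and at least [1]
     otherwise. *)
  pose c0 : 'cV[R]_(n + 1) := col_mx (2 *: map_mx intr a) (- (2 * b%:~R + 1))%:M.
  apply: (exists_many_tight _ _ _ v c0).
    move=> p; rewrite /c0 vE linearZ /= -scalemxAl [X in _ * (X + _)]mxE.
    have [A AE] : exists A : int, ((map_mx intr a)^T *m vertex R p) 0 0 = A%:~R.
      exists (\sum_i a i 0 * (p i)%:Z).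
      rewrite mxE (big_morph _ (@intrD R) (erefl _)).
      by apply: eq_bigr => i _; rewrite !mxE intrM -pmulrn.
    rewrite /f AE ler_int; case: (leP A b) => Ab /=.
      have : A%:~R <= b%:~R :> R by rewrite ler_int.
      by rewrite expr1; lra.
    have : (b + 1)%:~R <= A%:~R :> R by rewrite ler_int lezD1.
    by rewrite expr0 intrD; lra.
  (* An affine functional vanishing at the origin and at the unit vectors is zero. *)
  move=> d dP; rewrite -[d]vsubmxK [dsubmx d]mx11_scalar.
  set d1 := usubmx d; set d0 := dsubmx d 0 0.
  have d1P p : (d1^T *m vertex R p) 0 0 + d0 = 0.
    have := dP p; rewrite -[d]vsubmxK [dsubmx d]mx11_scalar vE => /eqP.
    by rewrite mulf_eq0 signr_eq0 => /eqP.
  have d00 : d0 = 0.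
    have := d1P [ffun => false]; rewrite mxE big1 ?add0r // => i _.
    by rewrite !mxE ffunE mulr0.
  have -> : d1 = 0.
    apply/colP => i; have := d1P [ffun k => k == i].
    rewrite d00 addr0 mxE (bigD1 i) //= big1 ?addr0.
      by rewrite !mxE ffunE eqxx mulr1.
    by move=> k /negPf ki; rewrite !mxE ffunE ki mulr0.
  by rewrite d00 raddf0 col_mx0.
rewrite -[c]vsubmxK [dsubmx c]mx11_scalar in cP cS.
move: (usubmx c) (dsubmx c 0 0) cP cS => {}c c0 cP; set S := [set p | _]%SET => cS.
(* Pigeonhole: of the at least five tight points, given by [4 <= n], three agree on feasibility and
   hence on the value of [c]. *)
have [e e2] : exists e, (2 < #|[set p in S | f p == e]%SET|)%N.
  have [e2|e2] := ltnP 2 #|[set p in S | f p == true]%SET|; first by exists true.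
  exists false; have : S = ([set p in S | f p == true] :|: [set p in S | f p == false])%SET.
    by apply/setP => p; rewrite !inE -andb_orr; case: (f p); rewrite andbT.
  move=> SE; have := leq_card_setU [set p in S | f p == true]%SET [set p in S | f p == false]%SET.
  by rewrite -SE => [[]]; lia.
have tight p : p \in [set p in S | f p == e]%SET -> (c^T *m vertex R p) 0 0 = (-1) ^+ e - c0.
  rewrite !inE vE => /andP[/eqP tp /eqP <-].
  by case: (f p) tp; rewrite ?expr0 ?expr1; lra.
have /card_gt2P[p1 [p2 [p3 [[p1S p2S p3S] neq]]]] := e2.
exists c, p1, p2, p3; split => //.
- by rewrite mulmxBr [X in X - _]mx11_scalar [X in _ - X]mx11_scalar !tight // subrr.
- by rewrite mulmxBr [X in X - _]mx11_scalar [X in _ - X]mx11_scalar !tight // subrr.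
move=> p q cpq; have := cP p; have := cP q; rewrite !vE cpq.
by case: (f p); case: (f q) => //=; rewrite ?expr0 ?expr1; lra.
Qed.

(** * Equality of the two hulls *)

Lemma convex_open_halfspace (R : numFieldType) (n : nat) (w : 'rV[R]_n) (b : R) :
  @convex_set R 'cV[R]_n [set y | b < (w *m y) 0 0].
Proof.
apply/convex_setW => y y' + + l l0 l1; rewrite !in_setE /= => yb y'b.
change (b < (w *m (l%:num *: y + (1 - l%:num) *: y')) 0 0).
rewrite mulmxDr -!scalemxAr [ltRHS]mxE [X in X + _]mxE [X in _ + X]mxE.
have -> : b = l%:num * b + (1 - l%:num) * b by ring.
by rewrite ltrD // ltr_pM2l // subr_gt0.
Qed.

Theorem theorem23 (R : realType) (n : nat) (hn : (4 <= n)%N)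
    (a : 'cV[int]_n) (b : int) :
  let P : set 'cV[R]_n := knapsack01 R a b in
  exists W : 'M[int]_(n - 2, n),
    conv_hull (P `&` int_points R n) =
    conv_hull [set x | P x /\ int_points R (n - 2) (map_mx intr W *m x)].
Proof.
move=> P.
have [c [p1 [p2 [p3 [[p12 p23 p31] cU cV cP]]]]] :=
  exists_three_level_functional R n hn a b.
have [W WP] := plane_int_matrix R n p1 p2 p3 p12 p23 p31.
exists W; apply/seteqP; split.
  move=> x Px C [cC WC]; apply: Px; split => // y [Py yint]; apply: WC.
  split => //; apply: mxOverM yint; apply/mxOverP => i j.
  by rewrite mxE intr_int.
move=> x Px C [cC PC]; apply: Px; split => // {}x [[x01 ax] /WP[z [s [t [zint xE]]]]].
have := cube01_plane_hull _ _ _ _ _ _ _ _ _ x01 zint xE.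
set Q := [set y | _] => Qx.
have Qc y : Q y -> c^T *m y = c^T *m x.
  by move=> [_ _ [s' [t' ->]]]; rewrite !mulmxDr -!scalemxAr cU cV !scaler0 !addr0.
(* Points of [Q] are 0/1 points on one level of [c], so one feasible point makes them all
   feasible. *)
have Qf y y' : Q y -> Q y' -> P y -> P y'.
  move=> Qy Qy' [_ ay]; case: (Qy') => y'01 y'int _; split => //; move: ay.
  have [y01 yint _] := Qy.
  move: Qy Qy'.
  have [p ->] := cube01_int_vertex _ _ _ y01 yint.
  have [q ->] := cube01_int_vertex _ _ _ y'01 y'int.
  by move=> /Qc yc /Qc y'c; rewrite (cP p q) // yc.
have [[y [Qy Py]]|QP] := pselect (exists y, Q y /\ P y).
  apply: Qx; split => // y' Qy'; apply: PC; split; first exact: Qf Py.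
  by case: Qy'.
(* If no point of [Q] is feasible, this convex set contains [Q], hence also [x], contradicting
   [ax]. *)
pose above := [set y : 'cV[R]_n | b%:~R < ((map_mx intr a)^T *m y) 0 0].
suff : above x by rewrite /above /= ltNge ax.
apply: Qx; split; first exact: convex_open_halfspace.
move=> y Qy; rewrite /above /= ltNge; apply/negP => ay.
by apply: QP; exists y; split => //; split => //; case: Qy.
Qed.
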